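(* Let $X$ be a complex Banach space of dimension at least $2$. Every atomic Boolean subspace lattice $\mathfrak{B}$ in $X$ is reflexive, that is, $\operatorname{Lat}\operatorname{Alg}(\mathfrak{B})=\mathfrak{B}$.
   Context: A subspace of $X$ means a closed linear subspace; $\mathfrak{C}(X)$ is the family of all subspaces of $X$. Joins and meets: $\bigvee_j M_j$ is the closed linear span of the $M_j$ (so $M\vee N=\overline{M+N}$), $\bigwedge_j M_j=\bigcap_j M_j$, with $\bigvee\emptyset=\{0\}$ and $\bigwedge\emptyset=X$. A subspace lattice in $X$ is a family $\mathfrak{L}\subseteq\mathfrak{C}(X)$ containing $\{0\}$ and $X$ and closed under arbitrary joins and meets. A subspace lattice is Boolean if it is distributive (both finite distributive laws hold for $\vee,\wedge$) and complemented (for each $M\in\mathfrak{L}$ there is $M'\in\mathfrak{L}$ with $M\wedge M'=\{0\}$, $M\vee M'=X$). An atom of $\mathfrak{L}$ is an element $K\in\mathfrak{L}$ with $\{0\}\ne K\ne X$ such that any $M\in\mathfrak{L}$ with $M\subseteq K$ is $\{0\}$ or $K$. $\mathfrak{L}$ is atomic if every $M\in\mathfrak{L}$ is the join of the atoms contained in $M$. $\mathcal{B}(X)$ is the algebra of bounded linear operators on $X$; $\operatorname{Alg}(\mathfrak{F})=\{A\in\mathcal{B}(X): AM\subseteq M\text{ for all }M\in\mathfrak{F}\}$ and $\operatorname{Lat}(\mathcal{T})=\{M\in\mathfrak{C}(X): TM\subseteq M\text{ for all }T\in\mathcal{T}\}$. *)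

(* Defs.v *)
From HB Require Import structures.
From mathcomp Require Import all_boot all_order all_algebra.
From mathcomp Require Import all_classical all_reals all_analysis.
From mathcomp Require Import complex.

Set Implicit Arguments.
Unset Strict Implicit.
Unset Printing Implicit Defensive.

Import Order.TTheory GRing.Theory Num.Theory.
Import numFieldNormedType.Exports.

Local Open Scope classical_set_scope.
Local Open Scope ring_scope.

Section Subspaces.
Context {K : numFieldType} {X : normedModType K}.
Implicit Types (M N : set X) (F L : set (set X)).

Definition closed_subspace M : Prop :=
  closed M /\ GRing.submod_closed (mem M).

(* [n = 0] is allowed, so the empty family has join [set 0]. *)
Definition linear_span (S : set X) : set X :=
  [set x | exists (n : nat) (a : 'I_n -> K) (v : 'I_n -> X),
     (forall i, S (v i)) /\ x = \sum_(i < n) a i *: v i].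

Definition sjoin F : set X := closure (linear_span (\bigcup_(M in F) M)).

Definition smeet F : set X := \bigcap_(M in F) M.

Definition subspace_lattice L : Prop :=
  [/\ L `<=` closed_subspace, L [set 0], L setT &
      forall F, F `<=` L -> L (sjoin F) /\ L (smeet F)].

Definition sjoin2 M N : set X := sjoin [set M; N].

Definition smeet2 M N : set X := smeet [set M; N].

Definition distributive_lattice L : Prop :=
  forall M N P, L M -> L N -> L P ->
    smeet2 M (sjoin2 N P) = sjoin2 (smeet2 M N) (smeet2 M P) /\
    sjoin2 M (smeet2 N P) = smeet2 (sjoin2 M N) (sjoin2 M P).

Definition complemented_lattice L : Prop :=
  forall M, L M ->
    exists M', [/\ L M', smeet2 M M' = [set 0] & sjoin2 M M' = setT].

Definition boolean_subspace_lattice L : Prop :=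
  [/\ subspace_lattice L, distributive_lattice L & complemented_lattice L].

Definition lattice_atom L A : Prop :=
  [/\ L A, A <> [set 0], A <> setT &
      forall M, L M -> M `<=` A -> M = [set 0] \/ M = A].

Definition atomic_lattice L : Prop :=
  forall M, L M -> M = sjoin [set A | lattice_atom L A /\ A `<=` M].

Definition bounded_operator (A : {linear X -> X}) : Prop :=
  exists C : K, forall x, `|A x| <= C * `|x|.

Definition Alg F : set {linear X -> X} :=
  [set A | bounded_operator A /\ forall M, F M -> A @` M `<=` M].

Definition Lat (T : set {linear X -> X}) : set (set X) :=
  [set M | closed_subspace M /\ forall A, T A -> A @` M `<=` M].

End Subspaces.

(* Main.v *)
Require Import Defs.
From HB Require Import structures.
From mathcomp Require Import all_boot all_order all_algebra.
From mathcomp Require Import all_classical all_reals all_analysis.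
From mathcomp Require Import complex.
From mathcomp Require Import ring lra.

(** Let [N] be invariant under [Alg B]. For an atom [A] with complement [A'],
    every rank-one operator [f _ *: e] with [e] in [A] and [f] vanishing on [A']
    lies in [Alg B]; by Hahn-Banach, [N] is therefore contained in [A'] or
    contains [A]. Hence [N] contains the join of the atoms below it, and lies in
    the meet of the complements of the other atoms. The latter meet belongs to
    [B], and no atom below it can miss [N], since such an atom would lie in its
    own complement; by atomicity the meet is below the join, and [N] equals both.

    Hahn-Banach is obtained from the fact that a minimal sublinear functional is
    linear. *)

Import Order.TTheory GRing.Theory Num.Theory.
Import numFieldNormedType.Exports.

Local Open Scope classical_set_scope.
Local Open Scope ring_scope.

(** * Sublinear functionals *)

Section Sublinear.
Context {R : realType} {V : lmodType R}.
Implicit Types (p q : V -> R) (C : set (V * R)).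

Definition sublinear p : Prop :=
  (forall x y, p (x + y) <= p x + p y) /\
  (forall t x, 0 <= t -> p (t *: x) = t * p x).

(** Applying the scaling inequality to [t^-1] at [t *: x] reverses it. At the origin, the factors
    [2] and [2^-1] force [p 0 = 0]. *)
Lemma sublinear_weaken p :
    (forall x y, p (x + y) <= p x + p y) ->
    (forall t x, 0 < t -> p (t *: x) <= t * p x) -> sublinear p.
Proof.
move=> pD pZ; split=> // t x; rewrite le_eqVlt => /predU1P[<-|t0].
  have := pZ 2 0 ltac:(by []); have := pZ 2^-1 0 ltac:(by rewrite invr_gt0).
  by rewrite !scaler0 scale0r mul0r => h1 h2; apply/eqP; rewrite eq_le; lra.
apply/eqP; rewrite eq_le pZ //=.
have tV : 0 < t^-1 by rewrite invr_gt0.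
have := pZ _ (t *: x) tV; rewrite scalerA mulVf ?gt_eqF// scale1r.
by rewrite mulrC ler_pdivlMr// mulrC.
Qed.

Lemma sublinear0 p : sublinear p -> p 0 = 0.
Proof. by case=> _ pZ; rewrite -(scale0r 0) pZ// mul0r. Qed.

Lemma sublinear_geN p x : sublinear p -> - p (- x) <= p x.
Proof. by move=> ps; have := ps.1 x (- x); rewrite subrr sublinear0//; lra. Qed.

(** A pair [(v, c)] stands for the constraint [c <= f v] on a linear functional [f] yet to be found;
    the constraints satisfied by a given [f] form such a cone. *)
Definition convex_cone C : Prop :=
  [/\ C (0, 0), forall u v, C u -> C v -> C (u.1 + v.1, u.2 + v.2) &
      forall t u, 0 < t -> C u -> C (t *: u.1, t * u.2)].

(** This packs two demands on a linear [f], namely [f <= p] and the constraints in [C], into the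
    single bound [f <= cone_inf p C]. *)
Definition cone_inf p C (x : V) : R :=
  inf [set p (x + u.1) - u.2 | u in C].

Section ConeInf.
Context {p : V -> R} {C : set (V * R)}.
Hypotheses (ps : sublinear p) (Cc : convex_cone C).
Hypothesis Cp : forall u, C u -> u.2 <= p u.1.

Let has_lb x : has_lbound [set p (x + u.1) - u.2 | u in C].
Proof.
(* Writing [u.1] as [(x + u.1) + (- x)] gives [u.2 <= p u.1 <= p (x + u.1) + p (- x)]. *)
exists (- p (- x)) => _ [u Cu <-].
by have := ps.1 (x + u.1) (- x); rewrite addrAC subrr add0r; have := Cp _ Cu; lra.
Qed.

Lemma cone_inf_le x u : C u -> cone_inf p C x <= p (x + u.1) - u.2.
Proof. by move=> Cu; apply: ge_inf => //; exists u. Qed.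

Lemma le_cone_inf x a :
  (forall u, C u -> a <= p (x + u.1) - u.2) -> a <= cone_inf p C x.
Proof.
move=> h; apply: lb_le_inf; last by move=> _ [u Cu <-]; exact: h.
by case: Cc => C0 _ _; exists (p (x + 0) - 0), (0, 0).
Qed.

Lemma cone_inf_le_self x : cone_inf p C x <= p x.
Proof. by case: Cc => C0 _ _; have := cone_inf_le x _ C0; rewrite addr0 subr0. Qed.

Lemma cone_inf_leN u : C u -> cone_inf p C (- u.1) <= - u.2.
Proof. by move=> /(cone_inf_le (- u.1)); rewrite addNr sublinear0// add0r. Qed.

Lemma cone_inf_sublinear : sublinear (cone_inf p C).
Proof.
case: Cc => C0 CD CZ; apply: sublinear_weaken => [x y|t x t0].
  rewrite -lerBlDr; apply: le_cone_inf => u Cu.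
  rewrite lerBlDl -lerBlDr; apply: le_cone_inf => v Cv.
  have := cone_inf_le (x + y) _ (CD _ _ Cu Cv).
  by have := ps.1 (x + u.1) (y + v.1); rewrite /= addrACA; lra.
rewrite -ler_pdivrMl//; apply: le_cone_inf => u Cu.
rewrite ler_pdivrMl// mulrBr -(ps.2 _ _ (ltW t0)) scalerDr.
exact: (cone_inf_le _ _ (CZ _ _ t0 Cu)).
Qed.

End ConeInf.

(** The pointwise infimum works: it is finite because each member is at least [- p (- x)] at [x]. *)
Lemma chain_inf_sublinear p (A : set (V -> R)) :
    (forall q, A q -> sublinear q /\ forall x, q x <= p x) -> A !=set0 ->
    (forall q r, A q -> A r -> (forall x, q x <= r x) \/ (forall x, r x <= q x)) ->
  exists q, [/\ sublinear q, forall x, q x <= p x &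
    forall r, A r -> forall x, q x <= r x].
Proof.
move=> Ap [r0 Ar0] tot.
pose q x := inf [set r x | r in A].
have qle r x : A r -> q x <= r x.
  move=> Ar; apply: ge_inf; last by exists r.
  exists (- p (- x)) => _ [s As <-]; have [ss sp] := Ap _ As.
  by apply: le_trans (sublinear_geN s x ss); rewrite lerN2.
have le_q a x : (forall r, A r -> a <= r x) -> a <= q x.
  move=> h; apply: lb_le_inf; first by exists (r0 x), r0.
  by move=> _ [r Ar <-]; exact: h.
exists q; split; last by move=> r Ar x; exact: qle.
- apply: sublinear_weaken => [x y|t x t0].
    rewrite -lerBlDr; apply: (le_q _ x) => r Ar; rewrite lerBlDl -lerBlDr.
    apply: (le_q _ y) => s As; have [[rD _] _] := Ap _ Ar; have [[sD _] _] := Ap _ As.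
    (* To bound [q (x + y)] by [r x + s y], use subadditivity of the smaller of [r] and [s]. *)
    have [rs|sr] := tot _ _ Ar As.
      by have := qle _ (x + y) Ar; have := rD x y; have := rs y; lra.
    by have := qle _ (x + y) As; have := sD x y; have := sr x; lra.
  rewrite -ler_pdivrMl//; apply: (le_q _ x) => r Ar.
  by have [[_ rZ] _] := Ap _ Ar; rewrite ler_pdivrMl// -(rZ _ _ (ltW t0));
    exact: qle.
- by move=> x; apply: le_trans (qle _ x Ar0) _; exact: (Ap _ Ar0).2.
Qed.

Lemma minimal_sublinear p : sublinear p ->
  exists q, [/\ sublinear q, forall x, q x <= p x &
    forall r, sublinear r -> (forall x, r x <= q x) -> r = q].
Proof.
move=> ps.
pose T := {q | sublinear q /\ forall x, q x <= p x}.
(* The order is reversed, so that a maximal element from Zorn is a minimal functional. *)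
pose leT (q r : T) := `[< forall x, sval r x <= sval q x >].
have [|||A tot|q qmin] := @Zorn T leT.
- by move=> q; apply/asboolP.
- move=> q r s /asboolP rq /asboolP sr; apply/asboolP => x.
  exact: le_trans (sr x) (rq x).
- move=> [q hq] [r hr] /asboolP /= rq /asboolP /= qr; apply: eq_exist => /=.
  by apply/funext => x; apply/eqP; rewrite eq_le qr rq.
(* The empty chain has no usable infimum; [p] itself bounds it. *)
- have [->|/set0P[q0 Aq0]] := eqVneq A set0.
    by exists (exist _ p (conj ps (fun x => lexx _))).
  have [||q r [s As <-] [t At <-]|q [qs qp qA]] :=
      @chain_inf_sublinear p [set sval s | s in A].
  + by move=> _ [s _ <-]; exact: svalP s.
  + by exists (sval q0), q0.
  + by have [/asboolP ?|/asboolP ?] := tot _ _ As At; [right|left].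
  + exists (exist _ q (conj qs qp)) => s As; apply/asboolP => x /=.
    by apply: qA; exists s.
exists (sval q); have [qs qp] := svalP q; split=> // r rs rq.
have rp x : r x <= p x := le_trans (rq x) (qp x).
by rewrite -(qmin (exist _ r (conj rs rp)))//; apply/asboolP.
Qed.

(* Minimality forces [q x + q y <= q (x + y)], because the infimum of
   [q (x + t *: y) - t * q y] over [t >= 0] is sublinear and below [q]. *)
Lemma minimal_sublinear_linear q : sublinear q ->
    (forall r, sublinear r -> (forall x, r x <= q x) -> r = q) ->
  linear (q : V -> R^o).
Proof.
move=> qs qmin.
have qD x y : q (x + y) = q x + q y.
  pose C := [set (t *: y, t * q y) | t in [set t | 0 <= t]].
  have Cc : convex_cone C.
    split.
    - by exists 0 => //=; rewrite scale0r mul0r.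
    - move=> _ _ [s /= s0 <-] [t /= t0 <-]; exists (s + t) => /=.
        exact: addr_ge0.
      by rewrite scalerDl mulrDl.
    - move=> s _ s0 [t /= t0 <-]; exists (s * t) => /=.
        by rewrite mulr_ge0// ltW.
      by rewrite scalerA mulrA.
  have Cq u : C u -> u.2 <= q u.1 by move=> [t /= t0 <-] /=; rewrite qs.2.
  have C1 : C (y, q y) by exists 1 => //=; rewrite scale1r mul1r.
  have := cone_inf_le qs Cq x _ C1.
  rewrite (qmin _ (cone_inf_sublinear qs Cc Cq) (cone_inf_le_self qs Cc Cq)) /=.
  by have := qs.1 x y; move=> ? ?; apply/eqP; rewrite eq_le; lra.
have qN x : q (- x) = - q x.
  by have := qD x (- x); rewrite subrr sublinear0//; lra.
move=> a x y; rewrite qD; congr (_ + _).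
have [a0|/ltW a0] := leP 0 a; first exact: qs.2.
rewrite -[a]opprK scaleNr qN qs.2 ?oppr_ge0//.
by rewrite [RHS]scaleNr.
Qed.

(** Take [f] minimal below [cone_inf p C], hence linear. The bound [f (- u.1) <= - u.2] then becomes
    a lower bound on [f u.1]. *)
Theorem hahn_banach_cone p C : sublinear p -> convex_cone C ->
    (forall u, C u -> u.2 <= p u.1) ->
  exists f : {scalar V},
    (forall x, f x <= p x) /\ (forall u, C u -> u.2 <= f u.1).
Proof.
move=> ps Cc Cp.
have [q [qs qp qmin]] := minimal_sublinear _ (cone_inf_sublinear ps Cc Cp).
pose lq := GRing.isLinear.Build R V R^o _ q (minimal_sublinear_linear _ qs qmin).
pose f : {scalar V} := HB.pack (q : V -> R^o) lq.
exists f; split=> [x|u Cu].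
  exact: le_trans (qp x) (cone_inf_le_self ps Cc Cp x).
have := le_trans (qp _) (cone_inf_leN ps Cp _ Cu).
by rewrite -[q (- _)]/(f (- _)) linearN lerN2.
Qed.

End Sublinear.

(** * Separation in complex normed spaces *)

Section ComplexSeparation.
Context {R : realType}.
Local Open Scope complex_scope.

Lemma normc_i : `|'i%C : R[i]| = 1.
Proof. by rewrite normc_def /= expr0n add0r expr1n sqrtr1. Qed.

(** An alias that carries the real scalar action, kept apart from the complex one on [X]. *)
Definition realified (X : Type) : Type := X.

HB.instance Definition _ (X : lmodType R[i]) :=
  GRing.Zmodule.copy (realified X) X.

Section Realified.
Context {X : lmodType R[i]}.

Definition realified_scale (r : R) (x : realified X) : realified X :=
  r%:C *: (x : X).

Lemma realified_scaleA a b x :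
  realified_scale a (realified_scale b x) = realified_scale (a * b) x.
Proof. by rewrite /realified_scale scalerA rmorphM. Qed.

Lemma realified_scale1 : left_id 1 realified_scale.
Proof. by move=> x; exact: scale1r. Qed.

Lemma realified_scaleDr : right_distributive realified_scale +%R.
Proof. by move=> a x y; exact: scalerDr. Qed.

Lemma realified_scaleDl x : {morph realified_scale^~ x : a b / a + b}.
Proof. by move=> a b; rewrite /realified_scale rmorphD; exact: scalerDl. Qed.

HB.instance Definition _ := GRing.Zmodule_isLmodule.Build R (realified X)
  realified_scaleA realified_scale1 realified_scaleDr realified_scaleDl.

Variable u : {scalar realified X}.

(* A complex linear [f] satisfies [Im (f x) = - Re (f ('i *: x))]. *)
Definition complexify (x : X) : R[i] := u x +i* - u ('i%C *: x).

Lemma complexify_linear : linear (complexify : X -> R[i]^o).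
Proof.
have uD (x y : X) : u (x + y) = u x + u y by exact: linearD.
(* [u] is only real linear, so a complex scalar is split into its real and imaginary parts. *)
have uZ (a : R[i]) (x : X) : u (a *: x) = complex.Re a * u x + complex.Im a * u ('i%C *: x).
  rewrite [a in LHS]complexE scalerDl mulrC -scalerA uD.
  by congr (_ + _); exact: (@linearZ_LR R (realified X) R^o _ u).
have uii (x : X) : u ('i%C *: ('i%C *: x)) = - u x.
  by rewrite scalerA -expr2 sqr_i scaleN1r; exact: (@linearN _ (realified X) _ _ u).
move=> a x y; rewrite /complexify scalerDr !uD scalerA [_ * a]mulrC -scalerA.
rewrite !(uZ a) uii -[_ *: Complex _ _]/(a * Complex _ _).
by case: a => a b; apply/eqP; rewrite eq_complex /=; apply/andP; split; apply/eqP; ring.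
Qed.

HB.instance Definition _ :=
  GRing.isLinear.Build R[i] X R[i]^o _ complexify complexify_linear.

Lemma norm_complexify (x : X) :
  `|complexify x| <= `|u x|%:C + `|u ('i%C *: x)|%:C.
Proof.
rewrite [complexify x]complexE; apply: le_trans (ler_normD _ _) _.
by rewrite normrM normc_i mul1r !normc_def /= !expr0n !addr0 !sqrtr_sqr normrN.
Qed.

End Realified.

(** Hahn-Banach gives a real functional dominated by the norm, zero on [M] and positive at [x0],
    which is then complexified. The constant [2] comes from bounding the modulus by the sum of the
    real and imaginary parts. *)
Lemma separating_functional (X : normedModType R[i]) (M : set X) (x0 : X) :
    closed_subspace M -> ~ M x0 ->
  exists f : {scalar X},
    [/\ forall x, `|f x| <= 2 * `|x|, forall x, M x -> f x = 0 & f x0 != 0].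
Proof.
move=> [Mcl [M0 Mlin]] Mx0.
have {}M0 : M 0 by move: M0; rewrite inE.
have {}Mlin a x y : M x -> M y -> M (a *: x + y).
  by move=> Mx My; have := Mlin a x y; rewrite !inE; apply.
have MZ a x : M x -> M (a *: x) by move=> Mx; rewrite -[_ *: x]addr0; exact: Mlin.
(* [d] is the radius of a ball around [x0] that misses [M]; it is tested against [- m]. *)
have [d d0 dM] : exists2 d : R, 0 < d & forall m, M m -> d%:C <= `|x0 + m|.
  have : nbhs x0 (~` M) by apply: open_nbhs_nbhs; split=> //; exact: closed_openC.
  move=> /nbhs_ballP[e /= e0 eM].
  exists (complex.Re e); first by move: e0; rewrite ltcE => /andP[].
  move=> m Mm; rewrite (RRe_real (gtr0_real e0)) real_leNgt ?ger0_real// ?ltW//.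
  apply/negP => h; apply: (eM (- m)).
    by rewrite -ball_normE /= opprK.
  by rewrite -scaleN1r; exact: MZ.
(* The norm takes values in [R[i]], and Hahn-Banach needs a real-valued functional. *)
pose n (x : realified X) : R := complex.Re `|x : X|.
have nE x : (n x)%:C = `|x : X| by rewrite RRe_real.
have nsub : sublinear n.
  split=> [x y|t x t0].
    by rewrite -lecR rmorphD /= !nE; exact: ler_normD.
  apply: complexI; rewrite rmorphM /= !nE.
  by rewrite [LHS]normrZ ger0_norm// lecR.
(* The cone generated by [(x0, d)] and all [(m, 0)] with [m] in [M]: it asks for [d <= u x0] and
   [0 <= u m]. *)
pose C : set (realified X * R) :=
  [set (w.2%:C *: x0 + w.1, w.2 * d) | w in [set w : X * R | M w.1 /\ 0 <= w.2]].
have Cc : convex_cone C.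
  split.
  - by exists (0, 0) => //=; rewrite scale0r addr0 mul0r.
  - move=> _ _ [[m s] [/= Mm s0] <-] [[k t] [/= Mk t0] <-].
    exists (m + k, s + t) => /=.
      by split; [rewrite -[m]scale1r; exact: Mlin|exact: addr_ge0].
    by rewrite rmorphD scalerDl addrACA mulrDl.
  - move=> t _ t0 [[m s] [/= Mm s0] <-]; exists (t%:C *: m, t * s) => /=.
      split; last by rewrite mulr_ge0// ltW.
      exact: MZ.
    by rewrite rmorphM mulrA -scalerA -scalerDr.
have Cn w : C w -> w.2 <= n w.1.
  move=> [[m t] [/= Mm t0] <-] /=; rewrite -lecR nE.
  have [->|tn0] := eqVneq t 0; first by rewrite mul0r normr_ge0.
  have -> : t%:C *: x0 + m = t%:C *: (x0 + t%:C^-1 *: m).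
    by rewrite scalerDr scalerA mulfV ?scale1r// (inj_eq (@complexI _)).
  rewrite normrZ ger0_norm ?lecR// rmorphM ler_wpM2l ?lecR//.
  by apply: dM; exact: MZ.
have [u [un uC]] := hahn_banach_cone _ _ nsub Cc Cn.
have u_norm (x : X) : `|u x|%:C <= `|x|.
  rewrite -nE lecR ler_norml un andbT lerNl.
  have -> : - u x = u (- x : X) by rewrite -[RHS]/(u (- (x : realified X))) linearN.
  by apply: le_trans (un _) _; rewrite -lecR !nE normrN.
(* The constraint [0 <= u k] holds at both [m] and [- m]. *)
have uM (m : X) : M m -> u m = 0.
  have uge0 (k : X) : M k -> 0 <= u k.
    move=> Mk; have /uC /= : C (k, 0).
      by exists (k, 0) => //=; rewrite scale0r add0r mul0r.
    by [].
  move=> Mm; apply/eqP; rewrite eq_le uge0// andbT -oppr_ge0.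
  rewrite -linearN; apply: uge0.
  by rewrite -scaleN1r; exact: MZ.
exists (complexify u); split=> [x|m Mm|].
- apply: le_trans (norm_complexify u x) _.
  rewrite mulr_natl mulr2n; apply: lerD; first exact: u_norm.
  by apply: le_trans (u_norm _) _; rewrite normrZ normc_i mul1r.
- rewrite /= /complexify !uM ?oppr0//.
  exact: MZ.
- apply/eqP => /(congr1 (@complex.Re R)) /= ux0.
  have /uC /= : C (x0, d) by exists (0, 1) => /=; rewrite ?scale1r ?addr0 ?mul1r.
  by rewrite ux0 leNgt d0.
Qed.

End ComplexSeparation.

(** * Rank-one operators and subspace lattices *)

Section RankOne.
Context {K : numFieldType} {X : normedModType K}.

Definition rank_one (f : {scalar X}) (e x : X) : X := f x *: e.

Lemma rank_one_linear f e : linear (rank_one f e).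
Proof.
by move=> a x y; rewrite /rank_one linearP scalerDl scalerA.
Qed.

HB.instance Definition _ f e :=
  GRing.isLinear.Build K X X _ (rank_one f e) (rank_one_linear f e).

Lemma rank_one_bounded (f : {scalar X}) (e : X) (C : K) :
  (forall x, `|f x| <= C * `|x|) -> bounded_operator (rank_one f e).
Proof.
move=> fC; exists (C * `|e|) => x.
by rewrite normrZ mulrAC ler_wpM2r.
Qed.

End RankOne.

Section Lattice.
Context {K : numFieldType} {X : normedModType K}.
Implicit Types (M N A : set X) (F L : set (set X)).

Lemma closed_subspace0 M : closed_subspace M -> M 0.
Proof. by move=> [_ [+ _]]; rewrite inE. Qed.

Lemma closed_subspaceZ M a x : closed_subspace M -> M x -> M (a *: x).
Proof.
move=> Mcs Mx; have [_ [_ Mlin]] := Mcs.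
have := Mlin a x 0; rewrite !inE addr0; apply => //.
exact: closed_subspace0.
Qed.

Lemma closed_subspaceD M x y : closed_subspace M -> M x -> M y -> M (x + y).
Proof.
move=> [_ [_ Mlin]] Mx My.
by have := Mlin 1 x y; rewrite !inE scale1r; apply.
Qed.

Lemma sjoin_sub F M : closed_subspace M -> (forall A, F A -> A `<=` M) ->
  sjoin F `<=` M.
Proof.
move=> Mcs FM; rewrite (closure_id M).1; last by case: Mcs.
apply: closureS => _ [n [a [v [vF ->]]]].
elim/big_ind: _ => [|x y|i _]; first exact: closed_subspace0.
  exact: closed_subspaceD.
by apply: closed_subspaceZ => //; have [A FA Av] := vF i; exact: FM Av.
Qed.

Lemma sjoinS F G : F `<=` G -> sjoin F `<=` sjoin G.
Proof.
move=> FG; apply: closureS => _ [n [a [v [vF ->]]]].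
exists n, a, v; split=> // i; have [A FA Av] := vF i.
by exists A => //; exact: FG.
Qed.

Lemma smeet2E M N : smeet2 M N = M `&` N.
Proof.
apply/seteqP; split=> [x MNx|x [Mx Nx] _ [->|->]//].
by split; apply: MNx; [left|right].
Qed.

(** By distributivity, [M] is the join of its meets with [A] and [A'], and the first of these is
    zero. *)
Lemma disjoint_sub_complement L M A A' :
    subspace_lattice L -> distributive_lattice L -> L M -> L A -> L A' ->
    sjoin2 A A' = setT -> smeet2 A M = [set 0] -> M `<=` A'.
Proof.
move=> [Lcs _ _ _] Ldist LM LA LA' AA' AM x Mx.
have [+ _] := Ldist M A A' LM LA LA'.
rewrite AA' !smeet2E setIT [M `&` A]setIC -smeet2E AM => ME.
rewrite ME in Mx; apply: sjoin_sub Mx; first exact: Lcs.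
move=> B [->|->] y; last by case.
by move=> ->; apply: closed_subspace0; exact: Lcs.
Qed.

(* An atom [A] lies in [M] or meets it trivially; in the latter case [M] lies
   in the complement [A'], where [f] vanishes. *)
Lemma rank_one_Alg L A A' (f : {scalar X}) (e : X) (C : K) :
    boolean_subspace_lattice L -> lattice_atom L A -> L A' ->
    sjoin2 A A' = setT -> (forall x, `|f x| <= C * `|x|) ->
    (forall x, A' x -> f x = 0) -> A e ->
  Alg L (rank_one f e).
Proof.
move=> [Llat Ldist _] [LA _ _ Amin] LA' AA' fC fA' Ae.
split; first exact: rank_one_bounded fC.
move=> M LM _ [x Mx <-] /=; have [Lcs _ _ Lcl] := Llat.
have LAM : L (smeet2 A M) by apply: (Lcl _ _).2 => _ [->|->].
case: (Amin _ LAM) => [|AM0|AMA]; first by rewrite smeet2E => ? [].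
  have /fA' fx0 := disjoint_sub_complement _ _ _ _ Llat Ldist LM LA LA' AA' AM0 _ Mx.
  by rewrite /rank_one fx0 scale0r; apply: closed_subspace0; exact: Lcs.
apply: closed_subspaceZ; first exact: Lcs.
by move: Ae; rewrite -AMA smeet2E => -[].
Qed.

End Lattice.

(** * Reflexivity of atomic Boolean subspace lattices *)

Theorem theorem5 (R : realType) (X : completeNormedModType R[i])
  (hdim : exists x y : X, forall a b : R[i],
     a *: x + b *: y = 0 -> a = 0 /\ b = 0)
  (B : set (set X))
  (hbool : boolean_subspace_lattice B) (hatomic : atomic_lattice B) :
  Lat (Alg B) = B.
Proof.
have [[Bcs _ _ Bcl] _ Bcompl] := hbool.
apply/seteqP; split=> [N [Ncs NLat]|N BN]; last first.
  by split=> [|A [_ /(_ _ BN)]]; [exact: Bcs|].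
pose F := [set A | lattice_atom B A /\ A `<=` N].
pose G := [set A' | B A' /\ exists A,
  [/\ lattice_atom B A, ~ A `<=` N, smeet2 A A' = [set 0] & sjoin2 A A' = setT]].
have BF : B (sjoin F) by apply: (Bcl _ _).1 => A [[]].
have BG : B (smeet G) by apply: (Bcl _ _).2 => A [].
have NG : N `<=` smeet G.
  (* If [x] in [N] lay outside [A'], some [f] vanishing on [A'] would have [f x != 0]. Each [e] in
     [A] is then a multiple of [rank_one f e x], which is in [N], contradicting [AN]. *)
  move=> x Nx A' [BA' [A [Aat AN _ AA']]]; apply: contrapT => A'x.
  have [f [f2 fA' fx]] := separating_functional _ _ _ (Bcs _ BA') A'x.
  apply: AN => e Ae.
  have /NLat/(_ (rank_one f e x)) : Alg B (rank_one f e).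
    exact: rank_one_Alg f2 fA' Ae.
  move=> /(_ (ex_intro2 _ _ x Nx erefl)) /(closed_subspaceZ _ (f x)^-1 _ Ncs).
  by rewrite /rank_one scalerA mulVf// scale1r.
have GF : smeet G `<=` sjoin F.
  rewrite [smeet G](hatomic _ BG); apply: sjoinS => A [Aat AG]; split=> //.
  apply: contrapT => AN; have [BA A0 _ _] := Aat.
  have [A' [BA' AA'0 AA']] := Bcompl _ BA.
  (* Since [A] is not inside [N], its complement [A'] is one of the members of [G]. *)
  have AA's : A `<=` A' by move=> x /AG; apply; split=> //; exists A.
  by apply: A0; rewrite -AA'0 smeet2E; apply/esym/setIidPl.
suff -> : N = sjoin F by [].
apply/seteqP; split; first exact: subset_trans GF.
by apply: sjoin_sub => // A [].
Qed.
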